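(* Let $a_1\ne0$, $0<\varepsilon<1$, $T=1+\varepsilon$, $(y,x_0)\in M^2$, and $\widetilde{x}(t)=y+a_1\int_0^tx_0(\tau-1)\,d\tau$. Then the minimum energy problem $\|u\|_{L^2(0,T)}\to\min$, $u\in\mathcal{U}_T(y,x_0)$, has a unique solution $\widehat u$. It is given by $$\widehat u(t)=\begin{cases}\widehat u_0(t), & t\in[0,\varepsilon),\\ -a_1x_0(t-1), & t\in[\varepsilon,1),\\ -a_1\Big(\widetilde{x}(t-1)+\int_0^{t-1}\widehat u_0(\tau)\,d\tau\Big), & t\in[1,1+\varepsilon),\end{cases}$$ where $$\widehat u_0(t)=c\cosh(a_1t)+a_1^2\int_0^t\cosh(a_1(t-\tau))\,\widetilde{x}(\tau)\,d\tau,\qquad c=-\frac{a_1}{\sinh(a_1\varepsilon)}\Big(\widetilde{x}(\varepsilon)+a_1\int_0^\varepsilon\sinh(a_1(\varepsilon-\tau))\,\widetilde{x}(\tau)\,d\tau\Big).$$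
   Context: Consider the scalar retarded control equation $\dot x(t)=a_1x(t-1)+u(t)$, $t\ge0$, with control $u\in L^2_{loc}(0,\infty)$ and initial data $x(0)=y$, $x(t)=x_0(t)$ for $t\in[-1,0)$, where $(y,x_0)\in M^2=\mathbb{R}\times L^2(-1,0)$. For every such initial state and control there is a unique continuous solution $x(t)=x(t;y,x_0,u)$ on $[0,\infty)$. For $T>1$, the set of admissible controls $\mathcal{U}_T(y,x_0)$ is the set of $u\in L^2(0,T)$ such that $x(t;y,x_0,u)=0$ for all $t\in[T-1,T]$. *)

(* Defs.v *)
From HB Require Import structures.
From mathcomp Require Import all_boot all_order all_algebra.
From mathcomp Require Import all_classical all_reals all_analysis.
Set Implicit Arguments. Unset Strict Implicit. Unset Printing Implicit Defensive.
Import Order.TTheory GRing.Theory Num.Theory.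
Import numFieldNormedType.Exports.
Local Open Scope classical_set_scope.
Local Open Scope ring_scope.

Section Defs.
Variable R : realType.
Local Notation mu := (@lebesgue_measure R).

Definition cosh (x : R) : R := (expR x + expR (- x)) / 2.
Definition sinh (x : R) : R := (expR x - expR (- x)) / 2.

Definition L2 (a b : R) (f : R -> R) : Prop :=
  measurable_fun `[a, b] f /\ (\int[mu]_(x in `[a, b]) ((f x) ^+ 2)%:E < +oo)%E.

Definition L2norm (a b : R) (f : R -> R) : R :=
  Num.sqrt (fine (\int[mu]_(x in `[a, b]) ((f x) ^+ 2)%:E)).

(* x is the (continuous) solution on [0,T] of
   x'(t) = a1 x(t-1) + u(t), x(0) = y, x = x0 on [-1,0)  (integral form) *)
Definition is_solution (a1 T y : R) (x0 u x : R -> R) : Prop :=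
  {within `[0, T], continuous x} /\
  forall t, 0 <= t <= T ->
    x t = y + Rintegral mu `[0, t]
      (fun s => a1 * (if s - 1 < 0 then x0 (s - 1) else x (s - 1)) + u s).

Definition admissible (a1 T y : R) (x0 u : R -> R) : Prop :=
  L2 0 T u /\
  exists x, is_solution a1 T y x0 u x /\ (forall t, T - 1 <= t <= T -> x t = 0).

Definition xtil (a1 y : R) (x0 : R -> R) (t : R) : R :=
  y + a1 * Rintegral mu `[0, t] (fun s => x0 (s - 1)).

Definition cconst (a1 eps y : R) (x0 : R -> R) : R :=
  - (a1 / sinh (a1 * eps)) *
    (xtil a1 y x0 eps +
     a1 * Rintegral mu `[0, eps] (fun s => sinh (a1 * (eps - s)) * xtil a1 y x0 s)).

Definition uhat0 (a1 eps y : R) (x0 : R -> R) (t : R) : R :=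
  cconst a1 eps y x0 * cosh (a1 * t) +
  a1 ^+ 2 * Rintegral mu `[0, t] (fun s => cosh (a1 * (t - s)) * xtil a1 y x0 s).

Definition uhat (a1 eps y : R) (x0 : R -> R) (t : R) : R :=
  if t < eps then uhat0 a1 eps y x0 t
  else if t < 1 then - a1 * x0 (t - 1)
  else - a1 * (xtil a1 y x0 (t - 1) + Rintegral mu `[0, t - 1] (uhat0 a1 eps y x0)).

End Defs.

(* Main.v *)
Require Import Defs.
From HB Require Import structures.
From mathcomp Require Import all_boot all_order all_algebra.
From mathcomp Require Import all_classical all_reals all_analysis.
From mathcomp Require Import measurable_realfun ring lra.
Set Implicit Arguments. Unset Strict Implicit. Unset Printing Implicit Defensive.
Import Order.TTheory GRing.Theory Num.Theory.
Import numFieldNormedType.Exports.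
Local Open Scope classical_set_scope.
Local Open Scope ring_scope.

(** Let [xh] be the trajectory of [uh], and let [d = u - uh] for an admissible
    [u], with difference [z] of the trajectories.  The energy identity
    [E u = E uh + E d], which yields optimality and uniqueness at once, amounts
    to the orthogonality of [uh] and [d] in L^2(0, T).  On [0, eps], [z] is the
    primitive of [d]; after [eps] both trajectories vanish, which forces [d = 0]
    almost everywhere on [eps, 1] and [d t = - a1 * z (t - 1)],
    [uh t = - a1 * xh (t - 1)] on [1, T].  Hence, with [p = uhat0], the integral
    of [uh d] is that of [p d + a1^2 xh z] over [0, eps].  Since [p' = a1^2 xh],
    the latter integrand is the derivative of [p z], and [z] vanishes at both
    ends. *)

(** * Square-integrable functions on a segment *)

Section L2.
Context {R : realType}.
Local Notation mu := (@lebesgue_measure R).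
Implicit Types (a b c r : R) (f g : R -> R).

Lemma L2_integrable_sqr a b f :
  L2 a b f -> mu.-integrable `[a, b] (EFin \o (fun x => f x ^+ 2)).
Proof.
move=> [mf foo]; apply/integrableP; split.
  by apply/measurable_EFinP; exact: measurable_funX.
by under eq_integral => x _ do rewrite /= ger0_norm ?sqr_ge0//.
Qed.

(** The product is dominated in absolute value by [f ^+ 2 + g ^+ 2]. *)
Lemma L2_mul_integrable a b f g : L2 a b f -> L2 a b g ->
  mu.-integrable `[a, b] (EFin \o (fun x => f x * g x)).
Proof.
move=> Lf Lg.
apply: (le_integrable _ _ _
  (integrableD _ (L2_integrable_sqr Lf) (L2_integrable_sqr Lg))) => //.
- by apply/measurable_EFinP; apply: measurable_funM; [case: Lf|case: Lg].
- move=> x _ /=; rewrite lee_fin [leRHS]ger0_norm ?addr_ge0 ?sqr_ge0//.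
  rewrite ler_norml; apply/andP; split; nra.
Qed.

Lemma continuous_L2 a b f : {within `[a, b], continuous f} -> L2 a b f.
Proof.
move=> cf; split; first exact: subspace_continuous_measurable_fun.
have cf2 : {within `[a, b], continuous (fun x => f x ^+ 2)}.
  by move=> x; apply: continuousM; exact: cf.
by apply: integrable_lty => //; exact: continuous_compact_integrable (@segment_compact _ _ _) cf2.
Qed.

(** On a bounded segment the constant 1 is square integrable, and [f] is its own product with that
    constant. *)
Lemma L2_integrable a b f : L2 a b f -> mu.-integrable `[a, b] (EFin \o f).
Proof.
move=> Lf; have L1 : L2 a b (cst 1).
  by apply: continuous_L2 => x; exact: cst_continuous.
by apply: eq_integrable (L2_mul_integrable Lf L1) => // x _ /=; rewrite mulr1.
Qed.

Lemma eq_L2 a b f g : {in `[a, b]%classic, f =1 g} -> L2 a b f -> L2 a b g.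
Proof.
move=> fg [mf foo]; split; first exact: eq_measurable_fun mf.
by rewrite (@eq_integral _ _ _ mu _ (fun x => (f x ^+ 2)%:E))// => x xab; rewrite fg.
Qed.

Lemma L2S a b c d f : a <= c -> d <= b -> L2 a b f -> L2 c d f.
Proof.
move=> ac db [mf foo].
have cd : `[c, d] `<=` `[a, b] by apply: subset_itv; rewrite bnd_simp.
split; first exact: measurable_funS mf.
apply: le_lt_trans foo; apply: ge0_subset_integral => //=.
- by apply/measurable_EFinP; exact: measurable_funX.
- by move=> x _; rewrite lee_fin sqr_ge0.
Qed.

Lemma L2Z a b k f : L2 a b f -> L2 a b (fun x => k * f x).
Proof.
move=> Lf; split; first by apply: measurable_funM => //; case: Lf.
under eq_integral do rewrite exprMn EFinM.
apply: integrable_lty => //.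
by apply: integrableZl => //; exact: L2_integrable_sqr.
Qed.

Lemma L2D a b f g : L2 a b f -> L2 a b g -> L2 a b (fun x => f x + g x).
Proof.
move=> Lf Lg; split; first by apply: measurable_funD; [case: Lf|case: Lg].
have If := L2_integrable_sqr Lf.
have Ig := L2_integrable_sqr Lg.
have Ifg := L2_mul_integrable Lf Lg.
under eq_integral do rewrite sqrrD !EFinD.
apply: integrable_lty => //.
apply: integrableD => //; apply: integrableD => //.
have : mu.-integrable `[a, b] (fun x => 2%:E * (f x * g x)%:E)%E.
  exact: integrableZl.
by apply: eq_integrable => // x _ /=; rewrite -EFinM mulr_natl.
Qed.

Lemma L2B a b f g : L2 a b f -> L2 a b g -> L2 a b (fun x => f x - g x).
Proof.
move=> Lf Lg; apply: (eq_L2 (f := fun x => f x + (-1) * g x)).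
  by move=> x _; rewrite mulN1r.
by apply: L2D => //; exact: L2Z.
Qed.

(** Serves the control and the delay term, both defined by cases. The pieces [[a, b[] and [[b, c]]
    are disjoint, and passing from [[a, b[] to [[a, b]] costs only a null set. *)
Lemma L2_glue a b c f g : a <= b -> b <= c -> L2 a b f -> L2 b c g ->
  L2 a c (fun t => if t < b then f t else g t).
Proof.
move=> ab bc [mf foo] [mg goo].
set h := fun t => _.
have cE : `[a, c]%classic = `[a, b[ `|` `[b, c] :> set R.
  by rewrite -itv_bndbnd_setU// bnd_simp.
have hf : {in `[a, b[%classic, f =1 h}.
  by move=> x; rewrite inE/= in_itv/= /h => /andP[_ ->].
have hg : {in `[b, c]%classic, g =1 h}.
  by move=> x; rewrite inE/= in_itv/= /h => /andP[bx _]; rewrite ltNge bx.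
have mf' : measurable_fun `[a, b[ f by exact/measurable_fun_itv_bndo_bndcP.
have mh : measurable_fun `[a, c] h.
  rewrite cE; apply/measurable_funU => //.
  by split; [exact: eq_measurable_fun mf'|exact: eq_measurable_fun mg].
split => //.
rewrite cE ge0_integral_setU//=; last 3 first.
- by apply/measurable_EFinP; apply: measurable_funX; rewrite -cE.
- by move=> x _; rewrite lee_fin sqr_ge0.
- apply/disj_setPS => x [/=]; rewrite !in_itv/= => /andP[_ xb] /andP[].
  by rewrite leNgt xb.
have -> : (\int[mu]_(x in `[a, b[) ((h x) ^+ 2)%:E = \int[mu]_(x in `[a, b[) ((f x) ^+ 2)%:E)%E.
  by apply: eq_integral => x xab; rewrite hf.
have -> : (\int[mu]_(x in `[b, c]) ((h x) ^+ 2)%:E = \int[mu]_(x in `[b, c]) ((g x) ^+ 2)%:E)%E.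
  by apply: eq_integral => x xab; rewrite hg.
rewrite lte_add_pinfty// integral_itv_bndo_bndc//.
by apply/measurable_EFinP; exact: measurable_funX.
Qed.

End L2.

(** * Translation invariance of Lebesgue integrals *)

Definition translation {R : realType} (r x : R) : measurableTypeR R := x - r.

Lemma measurable_translation {R : realType} (r : R) :
  measurable_fun [set: measurableTypeR R] (translation r).
Proof. exact: measurable_funB. Qed.

Section translation.
Context {R : realType}.
Local Notation mu := (@lebesgue_measure R).
Implicit Types (a b c r : R) (f g : R -> R).

Lemma preimage_translation_itv r a b (b0 b1 : bool) :
  translation r @^-1` [set` Interval (BSide b0 a) (BSide b1 b)] =
  [set` Interval (BSide b0 (a + r)) (BSide b1 (b + r))].
Proof.
apply/seteqP; split => x /=; rewrite !in_itv/= /translation;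
  by case: b0; case: b1; rewrite /= ?lerBlDr ?lerBrDr ?ltrBlDr ?ltrBrDr.
Qed.

(** Lebesgue measure is determined by its values on bounded half-open intervals, and a translation
    preserves their lengths. *)
Lemma lebesgue_measure_translation r (A : set R) : measurable A ->
  pushforward mu (translation r) A = mu A.
Proof.
move=> mA; apply/esym; apply: lebesgue_measure_unique => //.
  exact: measurable_translation.
move=> mt _ [[a b]] _ <- /=.
rewrite /pushforward preimage_translation_itv !lebesgue_measure_itv/=.
by rewrite !lte_fin ltrD2r; case: ifP => // _; rewrite -!EFinD; congr _%:E; ring.
Qed.

Lemma ge0_integral_translation a b r (f : R -> \bar R) :
  measurable_fun `[a, b] f -> (forall x, 0 <= f x)%E ->
  (\int[mu]_(x in `[(a + r)%R, (b + r)%R]) f (x - r)%R = \int[mu]_(x in `[a, b]) f x)%E.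
Proof.
move=> mf f0; rewrite -preimage_translation_itv.
rewrite -(ge0_integral_pushforward (measurable_translation r))//.
apply: eq_measure_integral => [|mt A mA _]; first exact: measurable_translation.
exact: lebesgue_measure_translation.
Qed.

Lemma L2_translation a b r f : L2 a b f -> L2 (a + r) (b + r) (fun x => f (x - r)).
Proof.
move=> [mf foo]; split.
  rewrite -preimage_translation_itv => _ B mB.
  rewrite [X in measurable X](_ : _ = translation r @^-1` (`[a, b] `&` f @^-1` B)).
    by rewrite -[X in measurable X]setTI; apply: measurable_translation => //; exact: mf.
  by rewrite preimage_setI.
rewrite (ge0_integral_translation r (f := fun x => (f x ^+ 2)%:E))//.
- by apply/measurable_EFinP; exact: measurable_funX.
- by move=> x; rewrite lee_fin sqr_ge0.
Qed.

(** The nonnegative case applies to the positive and negative parts separately. *)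
Lemma Rintegral_translation a b r f : mu.-integrable `[a, b] (EFin \o f) ->
  \int[mu]_(x in `[(a + r), (b + r)]) f (x - r) = \int[mu]_(x in `[a, b]) f x.
Proof.
move=> /measurable_int mf; rewrite /Rintegral; congr fine.
rewrite integralE [RHS]integralE.
rewrite -(ge0_integral_translation r (f := (fun x => (f x)%:E)^\+%E))//;
  last exact: measurable_funepos.
rewrite -(ge0_integral_translation r (f := (fun x => (f x)%:E)^\-%E))//;
  last exact: measurable_funeneg.
by congr (_ - _)%E; apply: eq_integral => x _; rewrite ?funeposE ?funenegE.
Qed.

End translation.

(** * Integrals over segments, Fubini on a triangle, integration by parts *)

Section primitives.
Context {R : realType}.
Local Notation mu := (@lebesgue_measure R).
Implicit Types (a b c r : R) (f g v : R -> R).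

Lemma EFin_Rintegral (D : set R) f : measurable D -> mu.-integrable D (EFin \o f) ->
  (\int[mu]_(x in D) (f x)%:E)%E = (\int[mu]_(x in D) f x)%:E.
Proof. by move=> mD If; rewrite /Rintegral fineK//; exact: integrable_fin_num. Qed.

Lemma integrable_itvS a b c d f : a <= c -> d <= b ->
  mu.-integrable `[a, b] (EFin \o f) -> mu.-integrable `[c, d] (EFin \o f).
Proof.
by move=> ac db; apply: integrableS => //; apply: subset_itv; rewrite bnd_simp.
Qed.

Lemma Rintegral_itv_cat a b c f : a <= b -> b <= c ->
  mu.-integrable `[a, c] (EFin \o f) ->
  \int[mu]_(x in `[a, c]) f x =
  \int[mu]_(x in `[a, b]) f x + \int[mu]_(x in `[b, c]) f x.
Proof.
move=> ab bc If; rewrite -(@Rintegral_itv_obnd_cbnd R b).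
  rewrite -(@Rintegral_itvB R f (BLeft a) (BRight c) b)//.
  by rewrite addrC subrK.
by apply: integrableS If => //; apply: subset_itv; rewrite bnd_simp.
Qed.

Lemma L2_primitive_continuous a b f : a <= b -> L2 a b f ->
  {within `[a, b], continuous (fun t => \int[mu]_(s in `[a, t]) f s)}.
Proof.
by move=> ab /L2_integrable If; exact: (parameterized_integral_continuous ab If).
Qed.

(** Both sides are iterated integrals of [v t * g s] over the triangle [a <= s <= t <= b]. *)
Lemma Fubini_triangle a b v g :
  mu.-integrable `[a, b] (EFin \o v) -> mu.-integrable `[a, b] (EFin \o g) ->
  (\int[mu]_(t in `[a, b]) (v t * \int[mu]_(s in `[a, t]) g s)%:E =
   \int[mu]_(s in `[a, b]) (g s * \int[mu]_(t in `[s, b]) v t)%:E)%E.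
Proof.
move=> Iv Ig.
pose v' := v \_ `[a, b]; pose g' := g \_ `[a, b].
have Iv' : mu.-integrable setT (EFin \o v').
  by move/integrable_mkcond : Iv; rewrite restrict_EFin; apply.
have Ig' : mu.-integrable setT (EFin \o g').
  by move/integrable_mkcond : Ig; rewrite restrict_EFin; apply.
have mv' : measurable_fun setT v' by apply/measurable_EFinP; exact: measurable_int Iv'.
have mg' : measurable_fun setT g' by apply/measurable_EFinP; exact: measurable_int Ig'.
(* The test [z.2 <= z.1] cuts out the triangle, and [v] and [g] are extended by zero, so that Fubini
   applies on the whole plane. *)
pose F (z : measurableTypeR R * measurableTypeR R) : \bar R :=
  (if z.2 <= z.1 then v' z.1 * g' z.2 else 0)%:E.
have mF : measurable_fun setT F.
  apply/measurable_EFinP; apply: measurable_fun_ifT => //.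
  - exact: measurable_fun_ler.
  - by apply: measurable_funM; exact: measurableT_comp.
(* The product without the cut is integrable because its variables separate; it dominates [F]. *)
have IP : (mu \x mu)%E.-integrable setT (fun z => (v' z.1 * g' z.2)%:E).
  apply/integrable12ltyP.
    by apply/measurable_EFinP; apply: measurable_funM; exact: measurableT_comp.
  under eq_integral => t _.
    under eq_integral do rewrite /= normrM EFinM.
    rewrite integralZl//; last exact: integrable_norm.
    rewrite EFin_Rintegral//; last exact: integrable_norm.
    over.
  apply: integrable_lty => //; apply: integrableZr => //.
  exact: integrable_norm.
have IF : (mu \x mu)%E.-integrable setT F.
  apply: le_integrable IP => // z _; rewrite /F /= lee_fin.
  by case: ifP => // _; rewrite normr0.
rewrite [RHS]integral_mkcond [LHS]integral_mkcond; have := Fubini IF.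
have -> : (fun t => \int[mu]_s F (t, s))%E =
    (fun t => (v t * \int[mu]_(s in `[a, t]) g s)%:E)%E \_ `[a, b].
  apply/funext => t; rewrite patchE; case: ifPn => [|/negP].
    rewrite inE/= in_itv/= => /andP[at_ tb].
    rewrite EFinM -EFin_Rintegral//; last exact: integrable_itvS Ig.
    rewrite -integralZl//; last exact: integrable_itvS Ig.
    rewrite [RHS]integral_mkcond; apply: eq_integral => s _.
    rewrite /F /v' /g' !patchE/= !mem_setE/= !in_itv/= at_ tb/=.
    have [st|st] := leP s t; last by rewrite andbF.
    rewrite (le_trans st tb) !andbT; case: ifP => _; first by [].
    by congr _%:E; exact: mulr0.
  move=> tab; rewrite (eq_integral (cst 0%E)) ?integral0// => s _.
  rewrite /F /v' patchE/= memNset; last by move: tab; rewrite inE.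
  by case: ifP => // _; congr _%:E; exact: mul0r.
have -> : (fun s => \int[mu]_t F (t, s))%E =
    (fun s => (g s * \int[mu]_(t in `[s, b]) v t)%:E)%E \_ `[a, b].
  apply/funext => s; rewrite patchE; case: ifPn => [|/negP].
    rewrite inE/= in_itv/= => /andP[as_ sb].
    rewrite EFinM -EFin_Rintegral//; last exact: integrable_itvS Iv.
    rewrite -integralZl//; last exact: integrable_itvS Iv.
    rewrite [RHS]integral_mkcond; apply: eq_integral => t _.
    rewrite /F /v' /g' !patchE/= !mem_setE/= !in_itv/= as_ sb/=.
    have [st|st] := leP s t; last by [].
    rewrite (le_trans as_ st)/=; case: ifP => _; first by rewrite EFinM muleC.
    by congr _%:E; exact: mul0r.
  move=> sab; rewrite (eq_integral (cst 0%E)) ?integral0// => t _.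
  rewrite /F /g' patchE/= (@memNset _ _ s); last by move: sab; rewrite inE.
  by case: ifP => // _; congr _%:E; exact: mulr0.
by [].
Qed.

(* The primitives are only absolutely continuous, so that differentiating their
   product is not available; Fubini on a triangle is used instead. *)
Lemma integration_by_parts_L2 a b v g : a <= b -> L2 a b v -> L2 a b g ->
  \int[mu]_(t in `[a, b]) (v t * \int[mu]_(s in `[a, t]) g s) +
  \int[mu]_(t in `[a, b]) (g t * \int[mu]_(s in `[a, t]) v s) =
  (\int[mu]_(t in `[a, b]) v t) * (\int[mu]_(t in `[a, b]) g t).
Proof.
move=> ab Lv Lg; have Iv := L2_integrable Lv; have Ig := L2_integrable Lg.
have IgV := L2_mul_integrable Lg (continuous_L2 (L2_primitive_continuous ab Lv)).
rewrite {1}/Rintegral Fubini_triangle// -/(Rintegral _ _ _).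
have -> : \int[mu]_(s in `[a, b]) (g s * \int[mu]_(t in `[s, b]) v t) =
    \int[mu]_(t in `[a, b]) (g t * (\int[mu]_(s in `[a, b]) v s) -
                             g t * (\int[mu]_(s in `[a, t]) v s)).
  apply: eq_Rintegral => t; rewrite inE/= in_itv/= => /andP[at_ tb].
  by rewrite -mulrBr (Rintegral_itv_cat at_ tb Iv) addrAC subrr add0r.
rewrite RintegralB//; last first.
  by apply: eq_integrable (integrableZl _ (\int[mu]_(s in `[a, b]) v s) Ig) => // x _ /=; rewrite -EFinM mulrC.
by rewrite RintegralZr// subrK mulrC.
Qed.

(** By Lebesgue differentiation the primitive of [g] has derivative [g t] at almost every [t], while
    a primitive vanishing on the segment has derivative 0 inside it. *)
Lemma ae0_Rintegral0 a b g : mu.-integrable `[a, b] (EFin \o g) ->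
  (forall t, a <= t <= b -> \int[mu]_(s in `[a, t]) g s = 0) ->
  {ae mu, forall t, t \in `[a, b] -> g t = 0}.
Proof.
(* Extension by zero: the differentiation theorem is applied to a function locally integrable on the
   whole line. *)
move=> Ig g0; pose h := g \_ `[a, b].
have Ih : mu.-integrable setT (EFin \o h).
  by move/integrable_mkcond : Ig; rewrite restrict_EFin; apply.
have Ihy y : mu.-integrable [set` Interval (BLeft a) (BRight y)] (EFin \o h).
  exact: integrableS Ih.
have Lh : locally_integrable setT h by exact: integrable_locally.
have aea c : {ae mu, forall x, x != c}.
  exists [set c]; split => //; first exact: lebesgue_measure_set1.
  by move=> x /= /negP; rewrite negbK => /eqP.
(* The end points are discarded: the primitive is known to vanish only on [[a, b]], and its
   derivative depends on a two-sided neighbourhood. *)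
move: (aea a) (aea b) (FTC1 Ihy Lh); apply: filterS3; first exact: (ae_filter_ringOfSetsType mu).
move=> x xa xb H; rewrite in_itv/= => /andP[ax bx].
have {}ax : a < x by rewrite lt_neqAle eq_sym xa.
have {}bx : x < b by rewrite lt_neqAle xb.
have <- : h x = g x by rewrite /h patchE mem_setE/= in_itv/= !ltW.
have [_ <-] := H ax.
rewrite derive1E (@near_eq_derive _ _ _ _ (cst 0)) ?derive_cst//.
near=> z.
have az : a <= z by apply: ltW; near: z; exact: lt_nbhsr.
have zb : z <= b by apply: ltW; near: z; exact: lt_nbhsl.
rewrite /= -[RHS](g0 z) ?az//; apply: eq_Rintegral => s.
rewrite inE/= in_itv/= => /andP[as_ sz].
by rewrite /h patchE mem_setE/= in_itv/= as_ (le_trans sz).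
Unshelve. all: by end_near. Qed.

End primitives.

(** * Hyperbolic functions *)

Section hyperbolic.
Context {R : realType}.
Implicit Types (a x y : R).

Lemma coshB x y : cosh (x - y) = cosh x * cosh y - sinh x * sinh y.
Proof. by rewrite /cosh /sinh opprB !expRD; field. Qed.

Lemma sinhB x y : sinh (x - y) = sinh x * cosh y - cosh x * sinh y.
Proof. by rewrite /cosh /sinh opprB !expRD; field. Qed.

Lemma cosh2_sinh2 x : cosh x ^+ 2 - sinh x ^+ 2 = 1.
Proof.
rewrite (_ : _ - _ = expR x * expR (- x)); last by rewrite /cosh /sinh; field.
by rewrite expRxMexpNx_1.
Qed.

Lemma cosh0 : cosh (0 : R) = 1.
Proof. by rewrite /cosh oppr0 expR0; lra. Qed.

Lemma sinh0 : sinh (0 : R) = 0.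
Proof. by rewrite /sinh oppr0 expR0; lra. Qed.

Lemma sinh_neq0 x : x != 0 -> sinh x != 0.
Proof.
move=> x0; rewrite /sinh mulf_neq0// subr_eq0.
by apply/eqP => /expR_inj /eqP; rewrite -addr_eq0 -mulr2n mulrn_eq0 (negbTE x0).
Qed.

Lemma is_derive_expRM a x :
  is_derive x 1 (fun t => expR (a * t)) (a * expR (a * x)).
Proof.
have da : is_derive x (1 : R) (fun t : R => a * t) a.
  by apply: is_derive_eq; rewrite /GRing.scale/= mulr1.
by have := is_derive1_comp (is_derive_expR (a * x)) da; rewrite mulrC.
Qed.

Lemma is_derive_cosh a x : is_derive x 1 (fun t => cosh (a * t)) (a * sinh (a * x)).
Proof.
rewrite (_ : (fun t => _) = (fun t => 2^-1 * (expR (a * t) + expR (- a * t)))).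
  have d1 := is_derive_expRM a x; have d2 := is_derive_expRM (- a) x.
  by apply: is_derive_eq; rewrite /sinh /GRing.scale/= !mulNr; ring.
by apply/funext => t; rewrite /cosh mulNr mulrC.
Qed.

Lemma is_derive_sinh a x : is_derive x 1 (fun t => sinh (a * t)) (a * cosh (a * x)).
Proof.
rewrite (_ : (fun t => _) = (fun t => 2^-1 * (expR (a * t) - expR (- a * t)))).
  have d1 := is_derive_expRM a x; have d2 := is_derive_expRM (- a) x.
  by apply: is_derive_eq; rewrite /cosh /GRing.scale/= !mulNr; ring.
by apply/funext => t; rewrite /sinh mulNr mulrC.
Qed.

Lemma continuous_coshM a : continuous (fun t => cosh (a * t)).
Proof.
by move=> x; apply/differentiable_continuous/derivable1_diffP; case: (is_derive_cosh a x).
Qed.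

Lemma continuous_sinhM a : continuous (fun t => sinh (a * t)).
Proof.
by move=> x; apply/differentiable_continuous/derivable1_diffP; case: (is_derive_sinh a x).
Qed.

End hyperbolic.

(** * The fundamental theorem of calculus on segments *)

Section ftc.
Context {R : realType}.
Local Notation mu := (@lebesgue_measure R).
Implicit Types (a b t : R) (f F q : R -> R).

Lemma Rintegral_FTC2 b f F :
  {within `[0, b], continuous f} -> {within `[0, b], continuous F} ->
  (forall x, 0 < x < b -> is_derive x 1 F (f x)) ->
  forall t, 0 <= t <= b -> \int[mu]_(s in `[0, t]) f s = F t - F 0.
Proof.
move=> cf cF dF t /andP[]; rewrite le_eqVlt => /predU1P[<- _|t0 tb].
  by rewrite set_itv1 Rintegral_set1 subrr.
have sub : `[0, t] `<=` `[0, b] by apply: subset_itvl; rewrite bnd_simp.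
have dF' x : 0 < x < t -> is_derive x 1 F (f x).
  by move=> /andP[x0 xt]; apply: dF; rewrite x0 (lt_le_trans xt).
rewrite /Rintegral (@continuous_FTC2 _ f F)//.
- exact: continuous_subspaceW cf.
- have /(continuous_within_itvP _ t0)[_ F0 Ft] := continuous_subspaceW sub cF.
  split => // x; rewrite in_itv/= => x0t.
  by have [] := dF' _ x0t.
- move=> x; rewrite in_itv/= => x0t; rewrite derive1E.
  by have [_ ->] := dF' _ x0t.
Qed.

Lemma is_derive_primitive b f : {within `[0, b], continuous f} ->
  forall x, 0 < x < b -> is_derive x 1 (fun t => \int[mu]_(s in `[0, t]) f s) (f x).
Proof.
move=> cf x /andP[x0 xb]; have b0 := lt_trans x0 xb.
have If := L2_integrable (continuous_L2 cf).
have [fc _ _] := (continuous_within_itvP _ b0).1 cf.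
have fx : {for x, continuous f} by apply: fc; rewrite in_itv/= x0.
have [dF F'] := @continuous_FTC1 _ f (BLeft 0) x b xb If x0 fx.
by apply: DeriveDef => //; rewrite -derive1E.
Qed.

Lemma within_continuousM (D : set R) f g : {within D, continuous f} ->
  {within D, continuous g} -> {within D, continuous (fun x => f x * g x)}.
Proof. by move=> cf cg x; apply: continuousM; [exact: cf|exact: cg]. Qed.

Lemma within_continuousD (D : set R) f g : {within D, continuous f} ->
  {within D, continuous g} -> {within D, continuous (fun x => f x + g x)}.
Proof. by move=> cf cg x; apply: continuousD; [exact: cf|exact: cg]. Qed.

Lemma within_continuousN (D : set R) f : {within D, continuous f} ->
  {within D, continuous (fun x => - f x)}.
Proof. by move=> cf x; apply: continuousN; exact: cf. Qed.

End ftc.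

(** * Variation of constants for the optimal control on the first interval *)

(** This is [w'] for the solution of [w'' = a ^+ 2 * (w + q)], [w 0 = 0], [w' 0 = c]. The function
    [uhat0] is the case [a = a1], [q = xtil], [c = cconst]. *)
Definition duhamel {R : realType} (a c : R) (q : R -> R) (t : R) : R :=
  c * cosh (a * t) + a ^+ 2 *
    \int[@lebesgue_measure R]_(s in `[0, t]) (cosh (a * (t - s)) * q s).

Section duhamel.
Context {R : realType}.
Local Notation mu := (@lebesgue_measure R).
Variables (a b c : R) (q : R -> R).
Hypotheses (a0 : a != 0) (b0 : 0 <= b) (cq : {within `[0, b], continuous q}).

Let ch t := cosh (a * t).
Let sh t := sinh (a * t).
Let C t := \int[mu]_(s in `[0, t]) (ch s * q s).
Let S t := \int[mu]_(s in `[0, t]) (sh s * q s).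
(** The addition formulas free the integrands of [t]: [p] is [duhamel] and [w] its primitive, both
    written with primitives [C] and [S] that the product rule can differentiate. *)
Let p t := c * ch t + a ^+ 2 * (ch t * C t - sh t * S t).
Let w t := c / a * sh t + a * (sh t * C t - ch t * S t).

Let cch : {within `[0, b], continuous ch}.
Proof. exact/continuous_subspaceT/continuous_coshM. Qed.
Let csh : {within `[0, b], continuous sh}.
Proof. exact/continuous_subspaceT/continuous_sinhM. Qed.
Let cchq := within_continuousM cch cq.
Let cshq := within_continuousM csh cq.
Let cC : {within `[0, b], continuous C}.
Proof. by apply: L2_primitive_continuous => //; exact: continuous_L2. Qed.
Let cS : {within `[0, b], continuous S}.
Proof. by apply: L2_primitive_continuous => //; exact: continuous_L2. Qed.
Let cc k : {within `[0, b], continuous (fun=> k : R)}.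
Proof. by move=> x; exact: cst_continuous. Qed.

Let cp : {within `[0, b], continuous p}.
Proof.
apply: within_continuousD; first exact: within_continuousM (@cc c) cch.
apply: (within_continuousM (@cc (a ^+ 2))); apply: within_continuousD.
  exact: within_continuousM.
by apply: within_continuousN; exact: within_continuousM.
Qed.

Let cw : {within `[0, b], continuous w}.
Proof.
apply: within_continuousD; first exact: within_continuousM (@cc (c / a)) csh.
apply: (within_continuousM (@cc a)); apply: within_continuousD.
  exact: within_continuousM.
by apply: within_continuousN; exact: within_continuousM.
Qed.

Let w0 : w 0 = 0.
Proof. by rewrite /w /C /S /sh /ch set_itv1 !Rintegral_set1 mulr0 sinh0; ring. Qed.

Let p0 : p 0 = c.
Proof. by rewrite /p /C /S /sh /ch set_itv1 !Rintegral_set1 mulr0 sinh0 cosh0; ring. Qed.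

(** The terms coming from the derivatives of [C] and [S] are [a * sh x * ch x * q x] with opposite
    signs, and cancel. *)
Let dw x : 0 < x < b -> is_derive x 1 w (p x).
Proof.
move=> xb.
have dC := is_derive_primitive cchq xb; have dS := is_derive_primitive cshq xb.
have dch := is_derive_cosh a x; have dsh := is_derive_sinh a x.
rewrite /w; apply: is_derive_eq; rewrite /p /GRing.scale/= -/(ch x) -/(sh x) -/(C x) -/(S x).
by field.
Qed.

Let dp x : 0 < x < b -> is_derive x 1 p (a ^+ 2 * (q x + w x)).
Proof.
move=> xb.
have dC := is_derive_primitive cchq xb; have dS := is_derive_primitive cshq xb.
have dch := is_derive_cosh a x; have dsh := is_derive_sinh a x.
rewrite /p; apply: is_derive_eq; rewrite /w /GRing.scale/= -/(ch x) -/(sh x) -/(C x) -/(S x).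
(* The derivatives of [C] and [S] contribute [a ^+ 2 * (ch x ^+ 2 - sh x ^+ 2) * q x], that is
   [a ^+ 2 * q x]. *)
have h := cosh2_sinh2 (a * x); rewrite -/(ch x) -/(sh x) in h.
rewrite -[in RHS](mul1r (q x)) -h.
by field.
Qed.

Local Notation P := (duhamel a c q).

Let pE t : 0 <= t <= b -> P t = p t.
Proof.
move=> /andP[t0 tb]; rewrite /duhamel /p; congr (_ + _ * _).
have I1 := integrable_itvS (lexx 0) tb (L2_integrable (continuous_L2 cchq)).
have I2 := integrable_itvS (lexx 0) tb (L2_integrable (continuous_L2 cshq)).
rewrite /C /S -RintegralZl// -RintegralZl// -RintegralB//; first last.
- exact: (integrableZl _ (sh t) I2).
- exact: (integrableZl _ (ch t) I1).
by apply: eq_Rintegral => s _; rewrite mulrBr coshB /ch /sh; ring.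
Qed.

Let wE t : 0 <= t <= b -> w t = c / a * sinh (a * t) +
  a * \int[mu]_(s in `[0, t]) (sinh (a * (t - s)) * q s).
Proof.
move=> /andP[t0 tb]; rewrite /w; congr (_ + _ * _).
have I1 := integrable_itvS (lexx 0) tb (L2_integrable (continuous_L2 cchq)).
have I2 := integrable_itvS (lexx 0) tb (L2_integrable (continuous_L2 cshq)).
rewrite /C /S -RintegralZl// -RintegralZl// -RintegralB//; first last.
- exact: (integrableZl _ (ch t) I2).
- exact: (integrableZl _ (sh t) I1).
by apply: eq_Rintegral => s _; rewrite mulrBr sinhB /ch /sh; ring.
Qed.

Let intP t : 0 <= t <= b -> \int[mu]_(s in `[0, t]) P s = w t.
Proof.
move=> tb; rewrite -[RHS]subr0 -[X in _ = _ - X]w0 -(Rintegral_FTC2 cp cw dw tb).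
apply: eq_Rintegral => s; rewrite inE/= in_itv/= => /andP[s0 st]; apply: pE.
by rewrite s0 (le_trans st)//; case/andP: tb.
Qed.

Lemma duhamel_continuous : {within `[0, b], continuous P}.
Proof.
move: cp; apply: subspace_eq_continuous => t; rewrite inE/= in_itv/= => tb.
by rewrite [RHS]pE.
Qed.

(** Taken at the final time, this closed form can be solved for [c], which is where [cconst] comes
    from. *)
Lemma duhamel_primitive t : 0 <= t <= b -> \int[mu]_(s in `[0, t]) P s =
  c / a * sinh (a * t) + a * \int[mu]_(s in `[0, t]) (sinh (a * (t - s)) * q s).
Proof. by move=> tb; rewrite intP// wE. Qed.

(** The Euler equation in integral form: the derivative of the control is [a ^+ 2] times the
    trajectory, which is [q] plus the primitive of the control. *)
Lemma duhamel_integral t : 0 <= t <= b ->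
  P t = c + \int[mu]_(s in `[0, t]) (a ^+ 2 * (q s + \int[mu]_(r in `[0, s]) P r)).
Proof.
move=> tb; rewrite pE// -[X in _ = X + _]p0 -[LHS](subrK (p 0)) [RHS]addrC; congr (_ + _).
have cg : {within `[0, b], continuous (fun s => a ^+ 2 * (q s + w s))}.
  by apply: (within_continuousM (@cc _)); exact: within_continuousD.
rewrite -(Rintegral_FTC2 cg cp dp tb).
apply: eq_Rintegral => s; rewrite inE/= in_itv/= => /andP[s0 st].
by rewrite intP// s0 (le_trans st)//; case/andP: tb.
Qed.

End duhamel.

(** * Null sets and almost-everywhere equality *)

Section null_sets.
Context {R : realType}.
Local Notation mu := (@lebesgue_measure R).
Implicit Types (a b : R) (f g : R -> R).

(** The right end point is negligible; this absorbs the change of formula of the control at [eps]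
    and of the delay term at 1. *)
Lemma eq_Rintegral_itvco a b f g :
  mu.-integrable `[a, b] (EFin \o f) -> mu.-integrable `[a, b] (EFin \o g) ->
  {in `[a, b[%classic, f =1 g} ->
  \int[mu]_(x in `[a, b]) f x = \int[mu]_(x in `[a, b]) g x.
Proof.
have co h : mu.-integrable `[a, b] (EFin \o h) -> mu.-integrable `[a, b[ (EFin \o h).
  by apply: integrableS => //; apply: subset_itvl; rewrite bnd_simp.
move=> If Ig fg; rewrite -!Rintegral_itv_bndo_bndc//; try exact: co.
exact: eq_Rintegral.
Qed.

Lemma ae_eq_Rintegral a b f g :
  mu.-integrable `[a, b] (EFin \o f) -> mu.-integrable `[a, b] (EFin \o g) ->
  {ae mu, forall t, t \in `[a, b] -> f t = g t} ->
  \int[mu]_(x in `[a, b]) f x = \int[mu]_(x in `[a, b]) g x.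
Proof.
move=> If Ig fg; congr fine; apply: ae_eq_integral => //.
- exact: measurable_int If.
- exact: measurable_int Ig.
- move: fg; apply: filterS; first exact: (ae_filter_ringOfSetsType mu).
  by move=> t fg tab /=; rewrite fg.
Qed.

Lemma L2_ae0 a b f : L2 a b f -> \int[mu]_(x in `[a, b]) (f x ^+ 2) = 0 ->
  {ae mu, forall t, t \in `[a, b] -> f t = 0}.
Proof.
move=> Lf f0; have If := L2_integrable_sqr Lf.
have f2ae : ae_eq mu `[a, b]%classic (fun x => (f x ^+ 2)%:E) (cst 0%E).
  apply/ae_eq_integral_abs => //; first exact: measurable_int If.
  under eq_integral do rewrite abse_EFin ger0_norm ?sqr_ge0//.
  by rewrite EFin_Rintegral// f0.
move: f2ae; apply: filterS.
by move=> t /= + tab => /(_ tab) [/eqP]; rewrite sqrf_eq0 => /eqP.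
Qed.

End null_sets.

(** * The delay term and the gluing of continuous pieces *)

Section delay.
Context {R : realType}.
Local Notation mu := (@lebesgue_measure R).
Implicit Types (T y b : R) (u x : R -> R).

Definition delayed (x0 x : R -> R) (s : R) := if s - 1 < 0 then x0 (s - 1) else x (s - 1).

Lemma L2_past (x0 : R -> R) : L2 (-1) 0 x0 -> L2 0 1 (fun s => x0 (s - 1)).
Proof. by move=> /(L2_translation 1); rewrite addNr add0r. Qed.

Lemma L2_delayed T (x0 : R -> R) x : 1 <= T -> L2 (-1) 0 x0 ->
  {within `[0, T], continuous x} -> L2 0 T (delayed x0 x).
Proof.
move=> T1 Lx0 cx.
apply: (eq_L2 (f := fun s => if s < 1 then x0 (s - 1) else x (s - 1))).
  by move=> s _; rewrite /delayed subr_lt0.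
apply: L2_glue => //; first exact: L2_past.
have := L2_translation 1 (L2S (lexx 0) (_ : T - 1 <= T) (continuous_L2 cx)).
by rewrite add0r subrK; apply; lra.
Qed.

Lemma xtil_continuous (a1 : R) y (x0 : R -> R) b : 0 <= b <= 1 -> L2 (-1) 0 x0 ->
  {within `[0, b], continuous xtil a1 y x0}.
Proof.
move=> /andP[b0 b1] Lx0.
apply: within_continuousD; first by move=> x; exact: cst_continuous.
apply: within_continuousM; first by move=> x; exact: cst_continuous.
apply: L2_primitive_continuous => //; exact: L2S (lexx 0) b1 (L2_past Lx0).
Qed.

Lemma itv_continuous_glue a b c (f g : R -> R) : a <= b -> b <= c -> f b = g b ->
  {within `[a, b], continuous f} -> {within `[b, c], continuous g} ->
  {within `[a, c], continuous (fun t => if t < b then f t else g t)}.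
Proof.
move=> ab bc fgb cf cg.
have -> : `[a, c]%classic = `[a, b] `|` `[b, c] :> set R.
  apply/seteqP; split => x /=; rewrite !in_itv/=.
    by move=> /andP[ax xc]; have [xb|bx] := leP x b; [left; rewrite ax|right; rewrite ltW].
  by case=> /andP[]; [move=> -> /le_trans ->|move=> /(le_trans ab) -> ->].
apply: withinU_continuous; try exact: itv_closed.
- move: cf; apply: subspace_eq_continuous => t; rewrite inE/= in_itv/= => /andP[_ tb].
  by rewrite /from_subspace; case: ltgtP tb => // ->.
- move: cg; apply: subspace_eq_continuous => t; rewrite inE/= in_itv/= => /andP[bt _].
  by rewrite /from_subspace ltNge bt.
Qed.

End delay.

(** * The candidate control and its trajectory *)

Section optimal_control.
Context {R : realType}.
Local Notation mu := (@lebesgue_measure R).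
Variables (a1 eps y : R) (x0 : R -> R).
Hypotheses (a10 : a1 != 0) (eps01 : 0 < eps < 1) (Lx0 : L2 (-1) 0 x0).

Let T := 1 + eps.
Let uh := uhat a1 eps y x0.
Let q := xtil a1 y x0.
Let p := uhat0 a1 eps y x0.
Let w t := \int[mu]_(s in `[0, t]) p s.
Let eps0 : 0 < eps. Proof. by case/andP: eps01. Qed.
Let eps1 : eps < 1. Proof. by case/andP: eps01. Qed.
Let eps_ge0 : 0 <= eps := ltW eps0.
Let epsT : eps <= T. Proof. by rewrite lerDr. Qed.
Let T1 : 1 <= T. Proof. by rewrite lerDl. Qed.

Let cq : {within `[0, eps], continuous q}.
Proof. by apply: xtil_continuous => //; rewrite eps_ge0 ltW. Qed.

Let cp : {within `[0, eps], continuous p}.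
Proof. exact: (@duhamel_continuous _ a1 eps (cconst a1 eps y x0) q). Qed.

Let cw : {within `[0, eps], continuous w}.
Proof. by apply: L2_primitive_continuous => //; exact: continuous_L2. Qed.

Let ck : {within `[0, eps], continuous (fun t => q t + w t)}.
Proof. exact: within_continuousD. Qed.

(* The constant [cconst] is chosen so that the trajectory reaches 0 at time [eps]. *)
Let w_eps : q eps + w eps = 0.
Proof.
have ee : 0 <= eps <= eps by rewrite eps_ge0 lexx.
have -> : w eps = _ := duhamel_primitive (cconst a1 eps y x0) a10 eps_ge0 cq ee.
rewrite /cconst -/q.
have s0 : sinh (a1 * eps) != 0 by rewrite sinh_neq0// mulf_neq0// gt_eqF.
by field; rewrite a10.
Qed.

Let p_integral t : 0 <= t <= eps ->
  p t = cconst a1 eps y x0 + \int[mu]_(s in `[0, t]) (a1 ^+ 2 * (q s + w s)).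
Proof. exact: (duhamel_integral (cconst a1 eps y x0) a10 eps_ge0 cq). Qed.

(** Trajectory of [uh]: up to [eps < 1] the delay reads [x0], so the state is [q] plus the primitive
    of the control; from then on it is held at 0. *)
Let xh t := if t < eps then q t + w t else 0.

(** The end point [eps] is included because [w_eps] makes the two branches agree there. *)
Let xh_itv t : t <= eps -> xh t = q t + w t.
Proof. by rewrite /xh; case: ltgtP => // ->. Qed.

Let cxh : {within `[0, T], continuous xh}.
Proof. by apply: itv_continuous_glue => // x; exact: cst_continuous. Qed.

(** From [eps] on, the control cancels the delay term. This covers both late branches of [uhat]: the
    delay reads [x0] before time 1, and [q + w] at [t - 1 <= eps] afterwards. *)
Let uhE t : t <= T -> uh t = if t < eps then p t else - a1 * delayed x0 xh t.
Proof.
move=> tT; rewrite /uh /uhat; case: ifPn => // _; rewrite /delayed subr_lt0.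
by case: ifPn => // _; rewrite xh_itv// lerBlDl.
Qed.

Let Ldelay x : {within `[0, T], continuous x} -> L2 0 T (delayed x0 x).
Proof. exact: L2_delayed. Qed.

Let Luh : L2 0 T uh.
Proof.
apply: (eq_L2 (f := fun t => if t < eps then p t else - a1 * delayed x0 xh t)).
  by move=> t; rewrite inE/= in_itv/= => /andP[_ tT]; rewrite uhE.
apply: L2_glue => //; first exact: continuous_L2.
by apply: L2Z; apply: L2S (Ldelay cxh).
Qed.

Let rate x u s := a1 * delayed x0 x s + u s.

Let Lrate x u : {within `[0, T], continuous x} -> L2 0 T u -> L2 0 T (rate x u).
Proof. by move=> cx Lu; apply: L2D => //; apply: L2Z; exact: Ldelay. Qed.

Let xh_eq t : 0 <= t <= T -> xh t = y + \int[mu]_(s in `[0, t]) rate xh uh s.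
Proof.
have Ir := L2_integrable (Lrate cxh Luh).
(* Up to [eps] the delay reads [x0] and the control is [p], except at [eps] itself, where [uhat] has
   already switched. *)
have early r : 0 <= r <= eps -> y + \int[mu]_(s in `[0, r]) rate xh uh s = q r + w r.
  move=> /andP[r0 re].
  have Lp : L2 0 r p by exact: L2S (lexx 0) re (continuous_L2 cp).
  have Lx : L2 0 r (fun s => x0 (s - 1)).
    by apply: L2S (lexx 0) _ (L2_past Lx0); rewrite (le_trans re)// ltW.
  rewrite (@eq_Rintegral_itvco _ _ _ _ (fun s => a1 * x0 (s - 1) + p s)).
  - rewrite RintegralD//; last 2 first.
    + exact: L2_integrable (L2Z _ Lx).
    + exact: L2_integrable.
    by rewrite RintegralZl//; [rewrite addrA|exact: L2_integrable].
  - by apply: integrable_itvS Ir; rewrite ?(le_trans re).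
  - by apply: L2_integrable; apply: L2D => //; exact: L2Z.
  - move=> s; rewrite inE/= in_itv/= => /andP[s0 sr].
    have se := lt_le_trans sr re.
    by rewrite /rate uhE ?se ?/delayed ?subr_lt0 ?(lt_trans se)// ltW// (lt_le_trans se).
move=> /andP[t0 tT]; have [te|et] := leP t eps.
  by rewrite early ?t0// xh_itv.
rewrite (Rintegral_itv_cat eps_ge0 (ltW et)); last exact: integrable_itvS Ir.
rewrite addrA early ?eps_ge0 ?lexx// w_eps add0r /xh ltNge ltW//=.
(* After [eps] the control cancels the delay, so the rate is 0 and the state stays at 0. *)
rewrite (@eq_Rintegral _ _ _ mu _ (fun=> 0)) ?Rintegral_cst ?mul0r//.
move=> s; rewrite inE/= in_itv/= => /andP[es st].
by rewrite /rate uhE ?(le_trans st)// ltNge es/= mulNr subrr.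
Qed.

Lemma admissible_uhat : admissible a1 (1 + eps) y x0 (uhat a1 eps y x0).
Proof.
split => //; exists xh; split; first by split => // t /xh_eq.
by move=> t /andP[+ _]; rewrite /T addrAC subrr add0r /xh ltNge => ->.
Qed.

(** * Comparison with an arbitrary admissible control *)

Section comparison.
Variable u : R -> R.
Hypothesis adm_u : admissible a1 T y x0 u.

Let d t := u t - uh t.

Let Lu : L2 0 T u. Proof. by case: adm_u. Qed.
Let Ld : L2 0 T d. Proof. exact: L2B. Qed.

Let orthogonal : \int[mu]_(t in `[0, T]) (uh t * d t) = 0.
Proof.
have [_ [x [[cx xE] xT]]] := adm_u.
pose z t := x t - xh t.
have z_late t : eps <= t <= T -> z t = 0.
  move=> /andP[et tT]; rewrite /z /xh ltNge et/= subr0 xT//.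
  by rewrite /T addrAC subrr add0r et.
have cz : {within `[0, T], continuous z}.
  by apply: within_continuousD => //; exact: within_continuousN.
pose e t := rate x u t - rate xh uh t.
have Le : L2 0 T e by apply: L2B; exact: Lrate.
have zE t : 0 <= t <= T -> z t = \int[mu]_(s in `[0, t]) e s.
  move=> tT; rewrite /z xE// xh_eq// /e RintegralB//.
  - by rewrite opprD addrACA subrr add0r.
  - by apply: integrable_itvS (L2_integrable (Lrate cx Lu)) => //; case/andP: tT.
  - by apply: integrable_itvS (L2_integrable (Lrate cxh Luh)) => //; case/andP: tT.
have eE s : e s = a1 * (delayed x0 x s - delayed x0 xh s) + d s.
  by rewrite /e /rate /d; ring.
(* Since [eps < 1], both delays read the same [x0] here and cancel in [e]. *)
have zd t : 0 <= t <= eps -> z t = \int[mu]_(s in `[0, t]) d s.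
  move=> /andP[t0 te]; rewrite zE ?t0 ?(le_trans te)//.
  apply: eq_Rintegral => s; rewrite inE/= in_itv/= => /andP[s0 st].
  by rewrite eE /delayed subr_lt0 (le_lt_trans (le_trans st te))// subrr mulr0 add0r.
(* As [z] vanishes from [eps] on, so does the integral of [e] over every [[eps, t]]. Hence [d] is
   minus the difference of the two delay terms, almost everywhere. *)
have d_late : {ae mu, forall s, s \in `[eps, T] -> e s = 0}.
  apply: ae0_Rintegral0; first exact: integrable_itvS (L2_integrable Le).
  move=> t /andP[et tT].
  have := zE t; rewrite z_late ?et// (le_trans eps_ge0 et) tT => /(_ isT)/esym.
  rewrite (Rintegral_itv_cat eps_ge0 et); last exact: integrable_itvS (L2_integrable Le).
  by rewrite -zE ?eps_ge0// z_late ?lexx ?epsT// add0r.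
(* By [p_integral], [g] is the derivative of [p]. *)
pose g s := a1 ^+ 2 * (q s + w s).
have cg : {within `[0, eps], continuous g}.
  by apply: within_continuousM => // s; exact: cst_continuous.
have Lg := continuous_L2 cg.
have Lde : L2 0 eps d by exact: L2S Ld.
have Luhd := L2_mul_integrable Luh Ld.
have zeps : \int[mu]_(s in `[0, eps]) d s = 0.
  by rewrite -zd ?eps_ge0 ?lexx// z_late// lexx.
(* Here [p] is a constant plus the primitive of [g]. The constant pairs with [d] to 0 by [zeps],
   which also kills the boundary term of the integration by parts. *)
have part1 : \int[mu]_(t in `[0, eps]) (uh t * d t) =
    - \int[mu]_(t in `[0, eps]) (g t * z t).
  have LG := continuous_L2 (L2_primitive_continuous eps_ge0 Lg).
  have IdG := L2_mul_integrable Lde LG.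
  rewrite (@eq_Rintegral_itvco _ _ _ _ (fun t => cconst a1 eps y x0 * d t +
      d t * \int[mu]_(s in `[0, t]) g s)).
  - rewrite RintegralD//; last exact: L2_integrable (L2Z _ Lde).
    rewrite RintegralZl//; last exact: L2_integrable.
    rewrite zeps mulr0 add0r.
    have := integration_by_parts_L2 eps_ge0 Lde Lg.
    rewrite zeps mul0r => /eqP; rewrite addr_eq0 => /eqP ->; congr (- _).
    apply: eq_Rintegral => t; rewrite inE/= in_itv/= => te.
    by rewrite zd.
  - exact: integrable_itvS Luhd.
  - exact: (integrableD _ (L2_integrable (L2Z _ Lde)) IdG).
  - move=> t; rewrite inE/= in_itv/= => /andP[t0 te].
    rewrite uhE ?te; last by rewrite (le_trans (ltW te)).
    by rewrite p_integral ?t0 ?ltW// mulrDl [in X in _ + X]mulrC.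
(* Almost everywhere after [eps], [m] equals [uh * d]: the two factors [- a1] multiply to
   [a1 ^+ 2]. *)
pose m s := a1 ^+ 2 * (delayed x0 xh s * (delayed x0 x s - delayed x0 xh s)).
have Im : mu.-integrable `[0, T] (EFin \o m).
  have Lh := Ldelay cxh.
  exact: (integrableZl _ (a1 ^+ 2) (L2_mul_integrable Lh (L2B (Ldelay cx) Lh))).
have part2 : \int[mu]_(t in `[eps, T]) (uh t * d t) =
    \int[mu]_(t in `[0, eps]) (g t * z t).
  transitivity (\int[mu]_(t in `[eps, T]) m t).
    apply: ae_eq_Rintegral.
    - exact: integrable_itvS Luhd.
    - exact: integrable_itvS Im.
    move: d_late; apply: filterS; first exact: (ae_filter_ringOfSetsType mu).
    move=> s es0 sT; have := es0 sT; move: sT; rewrite in_itv/= => /andP[es sT].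
    rewrite eE uhE// ltNge es/= => /eqP; rewrite addrC addr_eq0 => /eqP ->.
    by rewrite /m; ring.
  rewrite (Rintegral_itv_cat (ltW eps1) T1); last exact: integrable_itvS Im.
  (* Before time 1 both delays read [x0], so [m] vanishes. *)
  rewrite (@eq_Rintegral_itvco _ _ _ _ (fun=> 0)); first last.
  - move=> s; rewrite inE/= in_itv/= => /andP[_ s1].
    by rewrite /m /delayed subr_lt0 s1 subrr !mulr0.
  - exact: integrable0.
  - exact: integrable_itvS Im.
  rewrite Rintegral_cst// mul0r add0r.
  have Igz : mu.-integrable `[0, eps] (EFin \o (fun t => g t * z t)).
    by apply: L2_mul_integrable => //; apply: L2S (continuous_L2 cz).
  (* Shifting by the delay carries [[0, eps]] to [[1, T]], where [m s] is
     [g (s - 1) * z (s - 1)]. *)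
  rewrite -(Rintegral_translation 1 Igz) add0r [eps + 1]addrC.
  apply: eq_Rintegral => s; rewrite inE/= in_itv/= => /andP[s1 sT].
  by rewrite /m /delayed subr_lt0 ltNge s1/= /g -xh_itv ?lerBlDl// mulrA.
by rewrite (Rintegral_itv_cat eps_ge0 epsT Luhd) part1 part2 addNr.
Qed.

Lemma energy_decomposition :
  \int[mu]_(t in `[0, 1 + eps]) (u t ^+ 2) =
  \int[mu]_(t in `[0, 1 + eps]) (uhat a1 eps y x0 t ^+ 2) +
  \int[mu]_(t in `[0, 1 + eps]) ((u t - uhat a1 eps y x0 t) ^+ 2).
Proof.
rewrite -/T -/uh.
have Iuhd := L2_mul_integrable Luh Ld.
have Iuh := L2_integrable_sqr Luh; have Id := L2_integrable_sqr Ld.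
have I2 : mu.-integrable `[0, T] (EFin \o (fun t => 2 * (uh t * d t))).
  exact: (integrableZl _ 2 Iuhd).
rewrite (@eq_Rintegral _ _ _ mu _ (fun t => (uh t ^+ 2 + d t ^+ 2) + 2 * (uh t * d t))).
  rewrite RintegralD//; last exact: (integrableD _ Iuh Id).
  by rewrite RintegralD// RintegralZl// orthogonal mulr0 addr0.
by move=> t _; rewrite /d; ring.
Qed.

End comparison.
End optimal_control.

(** * Optimality and almost-everywhere uniqueness *)

Theorem mainTheorem5 (R : realType) (a1 eps y : R) (x0 : R -> R) :
  a1 != 0 -> 0 < eps < 1 -> L2 (-1) 0 x0 ->
  let T := 1 + eps in
  let uh := uhat a1 eps y x0 in
  [/\ admissible a1 T y x0 uh,
      (forall u, admissible a1 T y x0 u -> L2norm 0 T uh <= L2norm 0 T u) &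
      (forall u, admissible a1 T y x0 u ->
         (forall v, admissible a1 T y x0 v -> L2norm 0 T u <= L2norm 0 T v) ->
         {ae (@lebesgue_measure R), forall t, t \in `[0, T] -> u t = uh t})].
Proof.
move=> a10 eps01 Lx0 T uh.
have adm_uh : admissible a1 T y x0 uh by exact: admissible_uhat.
pose E (v : R -> R) := \int[@lebesgue_measure R]_(t in `[0, T]) (v t ^+ 2).
have E0 v : 0 <= E v by apply: Rintegral_ge0 => t _; exact: sqr_ge0.
have normE v : L2norm 0 T v = Num.sqrt (E v) by [].
have split u : admissible a1 T y x0 u -> E u = E uh + E (fun t => u t - uh t).
  exact: energy_decomposition.
split => // [u adm_u|u adm_u min_u].
  by rewrite !normE ler_sqrt// (split u)// lerDl.
have Ld : L2 0 T (fun t => u t - uh t) by apply: L2B; [case: adm_u|case: adm_uh].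
have Ed0 : E (fun t => u t - uh t) = 0.
  apply/le_anti; rewrite E0 andbT.
  (* Testing the minimality of [u] against [uh] leaves [E (u - uh) <= 0] in the decomposition. *)
  by have := min_u _ adm_uh; rewrite !normE ler_sqrt// (split u)// gerDl.
move: (L2_ae0 Ld Ed0).
apply: filterS; first exact: (ae_filter_ringOfSetsType lebesgue_measure).
by move=> t ud tT; apply/eqP; rewrite -subr_eq0; apply/eqP/ud.
Qed.
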